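(* Let $n$, $m$, $p$ be integers with $m \geq 2$ and $2 \leq p \leq n$. Let $X \subseteq \mathbb{C}^n$ be the set of all points $(a_1,\ldots,a_n)$ for which there are at least $p$ indices $i_1<\cdots<i_p$ with $a_{i_1}^m = a_{i_2}^m = \cdots = a_{i_p}^m$. Then the ideal of all polynomials in $\mathbb{C}[x_1,\ldots,x_n]$ vanishing on $X$ equals \[\Big\langle \prod_{i \equiv_{\lambda} j,\ i<j} (x_i^m - x_j^m) \;\Big|\; \lambda \text{ a set partition of } [n] \text{ with exactly } p-1 \text{ blocks}\Big\rangle.\]
   Context: $[n]=\{1,\ldots,n\}$. For a set partition $\lambda$ of $[n]$ into disjoint nonempty blocks, $i \equiv_\lambda j$ means that $i$ and $j$ lie in the same block of $\lambda$; the product runs over all pairs $i<j$ in a common block (an empty product equals $1$). *)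

(* Defs.v *)
From HB Require Import structures.
From mathcomp Require Import all_boot all_order all_algebra.
From mathcomp Require Import mpoly.
From mathcomp Require Import complex.
From mathcomp Require Import reals.

Set Implicit Arguments.
Unset Strict Implicit.
Unset Printing Implicit Defensive.

Import GRing.Theory.
Local Open Scope ring_scope.

Section Ideals.
Variables (K : comNzRingType) (n : nat).

Definition vanishing_ideal (X : ('I_n -> K) -> Prop) (f : {mpoly K[n]}) : Prop :=
  forall a : 'I_n -> K, X a -> f.@[a] = 0.

Definition ideal_generated (A : comNzRingType) (G : A -> Prop) (f : A) : Prop :=
  exists s : seq (A * A),
    (forall cg, cg \in s -> G cg.2) /\ f = \sum_(cg <- s) cg.1 * cg.2.

(* 'I_n = {0, ..., n-1} plays the role of [n]. *)
Definition same_block (P : {set {set 'I_n}}) (i j : 'I_n) : bool :=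
  [exists B in P, (i \in B) && (j \in B)].

Definition partition_product (m : nat) (P : {set {set 'I_n}}) : {mpoly K[n]} :=
  \prod_(i < n) \prod_(j < n | (i < j)%N && same_block P i j)
     ('X_i ^+ m - 'X_j ^+ m).

Definition partition_generator (m k : nat) (g : {mpoly K[n]}) : Prop :=
  exists P : {set {set 'I_n}},
    [/\ partition P [set: 'I_n], #|P| = k & g = partition_product m P].

(* A p-element set of indices is the same as an increasing list i_1 < ... < i_p. *)
Definition equal_powers_locus (m p : nat) (a : 'I_n -> K) : Prop :=
  exists I : {set 'I_n},
    #|I| = p /\ {in I &, forall i j, a i ^+ m = a j ^+ m}.

End Ideals.

(* Main.v *)
Require Import Defs.
From HB Require Import structures.
From mathcomp Require Import all_boot all_order all_algebra.
From mathcomp Require Import mpoly.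
From mathcomp Require Import complex.
From mathcomp Require Import reals.
From mathcomp Require Import boolp separable zify.

Set Implicit Arguments.
Unset Strict Implicit.
Unset Printing Implicit Defensive.

Import GRing.Theory Num.Theory.
Local Open Scope ring_scope.

(** The shape of a coloring is the sequence of its color class sizes, and the
    shape of a point [a] is the conjugate of the partition formed by the
    multiplicities of the values [a_i ^ m].  The product attached to a coloring
    is nonzero at [a] only if no two indices share both their color and the
    value of [a_i ^ m]; the shape of [a] then dominates that of the coloring.
    Conversely, if [D] is closed under dominance, every polynomial [f] that
    vanishes at all points with nonzero coordinates and shape outside [D] lies
    in the ideal generated by the colorings with shape in [D].  This goes by
    induction on the number of variables and on the degree [d] of [f] in the
    last one.  The coefficient of degree [d] vanishes at every point with more
    than [d] extensions of shape outside [D], where each value of [a_i ^ m]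
    contributes [m] extensions.  By induction it is a combination of colorings,
    each with a class of size at most [d / m] which the last index can join
    without leaving [D]; this lifts the coefficient to an element of the ideal,
    and subtracting it lowers the degree.  The theorem is the case where [D]
    consists of the shapes with at most [p - 1] classes. *)

(** * Shapes and dominance *)

Section Shapes.
Local Open Scope nat_scope.
Implicit Types (lam mu : nat -> nat) (d t x y : nat).

Definition is_shape lam :=
  {homo lam : s t /~ s <= t} /\ exists t, lam t = 0.

Definition prefix_sum lam t := \sum_(s < t) lam s.

Definition dominated lam mu := forall t, prefix_sum lam t <= prefix_sum mu t.

Definition dominance_closed (D : (nat -> nat) -> Prop) :=
  forall lam mu, is_shape lam -> is_shape mu -> dominated lam mu ->
    D lam -> D mu.

Definition add_box lam x : nat -> nat := fun t => lam t + (t == x).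

Definition first_le d lam x := lam x <= d /\ forall s, s < x -> d < lam s.

(* A new element joins the first class of size at most [d]. *)
Definition add_box_preimage d (D : (nat -> nat) -> Prop) lam :=
  exists2 x, first_le d lam x & D (add_box lam x).

Lemma first_le_exists d lam : is_shape lam -> exists x, first_le d lam x.
Proof.
case=> _ [t lam_t0].
have lam_le : exists t, lam t <= d by exists t; rewrite lam_t0.
exists (ex_minn lam_le); case: ex_minnP => x lam_x x_min; split=> // s lt_sx.
by rewrite ltnNge; apply/negP => /x_min; lia.
Qed.

Lemma prefix_sum0 lam : prefix_sum lam 0 = 0.
Proof. exact: big_ord0. Qed.

Lemma prefix_sumS lam t : prefix_sum lam t.+1 = prefix_sum lam t + lam t.
Proof. exact: big_ord_recr. Qed.

Lemma prefix_sum_add_box lam x t :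
  prefix_sum (add_box lam x) t = prefix_sum lam t + (x < t).
Proof.
elim: t => [|t IHt]; first by rewrite !prefix_sum0.
by rewrite !prefix_sumS IHt /add_box; lia.
Qed.

Lemma is_shape_add_box d lam x :
  is_shape lam -> first_le d lam x -> is_shape (add_box lam x).
Proof.
move=> [lam_anti [t0 lam_t0]] [lam_x lt_x]; split=> [t s le_st|].
  have := lam_anti _ _ le_st; rewrite /add_box.
  have [eq_tx|] := eqVneq t x; last lia.
  by have := lt_x s; rewrite -eq_tx in lam_x *; lia.
exists (maxn t0 x.+1); have := lam_anti _ _ (leq_maxl t0 x.+1).
by rewrite /add_box; lia.
Qed.

Lemma dominated_add_box lam x y :
  x <= y -> dominated (add_box lam y) (add_box lam x).
Proof. by move=> le_xy t; rewrite !prefix_sum_add_box; lia. Qed.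

Lemma dominated_add_first_box d lam mu x y :
  is_shape lam -> dominated lam mu -> first_le d lam x -> first_le d mu y ->
  dominated (add_box lam x) (add_box mu y).
Proof.
move=> [lam_anti _] dom [lam_x _] [_ lt_y] t; rewrite !prefix_sum_add_box.
(* Between [x] and [y] the terms of [lam] are at most [d], those of [mu] larger:
   the gap of the prefix sums grows at each step. *)
have gap j : x + j <= y -> prefix_sum lam (x + j) + j <= prefix_sum mu (x + j).
  elim: j => [|j IHj] le_j; first by rewrite !addn0; exact: dom.
  have := IHj ltac:(lia); rewrite (addnS x) !prefix_sumS.
  by have := lt_y (x + j); have := lam_anti _ _ (leq_addr j x); lia.
have := dom t; have [lt_xt|] := ltnP x t; last lia.
by have := gap (t - x); rewrite subnKC; lia.
Qed.

Lemma dominance_closed_add_box_preimage d D :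
  dominance_closed D -> dominance_closed (add_box_preimage d D).
Proof.
move=> closedD lam mu shape_lam shape_mu dom [x first_x Dx].
have [y first_y] := first_le_exists d shape_mu; exists y => //.
apply: closedD Dx.
- exact: is_shape_add_box first_x.
- exact: is_shape_add_box first_y.
- exact: dominated_add_first_box first_x first_y.
Qed.

Lemma dominance_closed_prefix_sum k r :
  dominance_closed (fun lam => k <= prefix_sum lam r).
Proof. by move=> lam mu _ _ dom /leq_trans; apply. Qed.

End Shapes.

(** * Fibers *)

Section Fibers.
Local Open Scope nat_scope.
Variables (I : finType) (T : eqType).
Implicit Types (f : I -> T) (v : T).

Definition fiber_card f v := #|[set i | f i == v]|.

(* The conjugate of the partition formed by the cardinals of the fibers. *)
Definition fiber_shape f t :=
  count (fun v => t < fiber_card f v) (undup (codom f)).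

Lemma sum_card_fibers f (A : {set I}) :
  \sum_(v <- undup (codom f)) #|[set i in A | f i == v]| = #|A|.
Proof.
under eq_bigr => v _ do rewrite -sum1dep_card big_mkcondr.
rewrite exchange_big -sum1_card; apply: eq_bigr => i _ /=.
rewrite (bigD1_seq (f i)) ?undup_uniq ?mem_undup ?codom_f //= eqxx.
by rewrite big1 // => v; rewrite eq_sym; case: eqP.
Qed.

Lemma sum_fiber_card f : \sum_(v <- undup (codom f)) fiber_card f v = #|I|.
Proof.
rewrite -cardsT -(sum_card_fibers f).
by apply: eq_bigr => v _; apply: eq_card => i; rewrite !inE.
Qed.

Lemma fiber_card_gt0 f v : (0 < fiber_card f v) = (v \in codom f).
Proof.
apply/card_gt0P/codomP => [|[i ->]]; last by exists i; rewrite inE.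
by move=> [i /[!inE] /eqP<-]; exists i.
Qed.

Lemma fiber_shapeE f s t : uniq s -> {subset codom f <= s} ->
  fiber_shape f t = \sum_(v <- s) (t < fiber_card f v).
Proof.
move=> s_uniq sub_s; rewrite /fiber_shape -big_mkcond sum1_count -!size_filter.
apply/perm_size/uniq_perm; rewrite ?filter_uniq ?undup_uniq // => v.
rewrite !mem_filter mem_undup; case: ltnP => //= lt_tv.
have f_v : v \in codom f by rewrite -fiber_card_gt0; lia.
by rewrite f_v sub_s.
Qed.

Lemma is_shape_fiber_shape f : is_shape (fiber_shape f).
Proof.
split=> [t s le_st|]; first by apply: sub_count => v /=; lia.
exists #|I|; apply/eqP; rewrite -leqn0 leqNgt -has_count.
by apply/hasPn => v _; rewrite -leqNgt max_card.
Qed.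

Lemma prefix_sum_fiber_shape f t :
  prefix_sum (fiber_shape f) t
    = \sum_(v <- undup (codom f)) minn (fiber_card f v) t.
Proof.
elim: t => [|t IHt]; first by rewrite prefix_sum0 big1 // => v _; rewrite minn0.
rewrite prefix_sumS IHt (@fiber_shapeE f (undup (codom f))) ?undup_uniq //.
  by rewrite -big_split; apply: eq_bigr => v _ /=; lia.
by move=> v; rewrite mem_undup.
Qed.

Lemma prefix_sum_fiber_shape_lt f r :
  prefix_sum (fiber_shape f) r < #|I| -> exists v, r < fiber_card f v.
Proof.
rewrite prefix_sum_fiber_shape -(sum_fiber_card f) => lt_sum.
suff /hasP[v _ lt_rv] : has (fun v => r < fiber_card f v) (undup (codom f)).
  by exists v.
apply: contraLR lt_sum => /hasPn le_r; rewrite -leqNgt !big_seq.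
by apply: leq_sum => v /le_r; lia.
Qed.

End Fibers.

Lemma prefix_sum_fiber_card (I : finType) (c : I -> nat) t :
  prefix_sum (fiber_card c) t = #|[set i | (c i < t)%N]|.
Proof.
elim: t => [|t IHt].
  by rewrite prefix_sum0; apply/esym/eq_card0 => i; rewrite inE.
rewrite prefix_sumS IHt -cardsUI addnC (_ : _ :&: _ = set0) ?cards0.
  by apply: eq_card => i; rewrite !inE; lia.
by apply/setP => i; rewrite !inE; lia.
Qed.

(* The [t] first colors meet a fiber of [b] in at most [t] points. *)
Lemma fiber_card_dominated (I : finType) (T : eqType)
    (b : I -> T) (c : I -> nat) :
  (forall i j, c i = c j -> b i = b j -> i = j) ->
  dominated (fiber_card c) (fiber_shape b).
Proof.
move=> inj_cb t; rewrite prefix_sum_fiber_card prefix_sum_fiber_shape.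
rewrite -(sum_card_fibers b); apply: leq_sum => v _; rewrite leq_min.
apply/andP; split; first by apply/subset_leq_card/subsetP => i /[!inE] /andP[].
rewrite cardE -(size_map c) -[leqRHS](size_iota 0); apply: uniq_leq_size.
  rewrite map_inj_in_uniq ?enum_uniq // => i j; rewrite !mem_enum !inE.
  by move=> /andP[_ /eqP bi] /andP[_ /eqP bj] /inj_cb->; rewrite ?bi.
by move=> _ /mapP[i + ->]; rewrite mem_enum mem_iota !inE => /andP[].
Qed.

Section Extend.
Variables (n : nat) (T : Type).
Implicit Types (f : 'I_n -> T) (v : T).

Definition extend f v (i : 'I_n.+1) : T := oapp f v (unlift ord_max i).

Lemma extend_widen f v i : extend f v (widen_ord (leqnSn n) i) = f i.
Proof.
rewrite (_ : widen_ord _ i = lift ord_max i) ?/extend ?liftK //.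
exact/val_inj/esym/lift_max.
Qed.

Lemma extend_max f v : extend f v ord_max = v.
Proof. by rewrite /extend unlift_none. Qed.

End Extend.

Section FibersOverOrdinals.
Local Open Scope nat_scope.
Variables (n : nat) (T : eqType).
Implicit Types (v w : T).

Lemma fiber_card_extend (f : 'I_n -> T) w v :
  fiber_card (extend f w) v = fiber_card f v + (v == w).
Proof.
rewrite /fiber_card -!sum1dep_card big_mkcond big_ord_recr /=.
rewrite extend_max (eq_sym w); congr (_ + _); rewrite [RHS]big_mkcond.
by apply: eq_bigr => i _; rewrite extend_widen.
Qed.

Lemma fiber_shape_extend (f : 'I_n -> T) w :
  fiber_shape (extend f w) = add_box (fiber_shape f) (fiber_card f w).
Proof.
apply/funext => t; rewrite /add_box; pose s := undup (w :: codom f).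
have s_uniq : uniq s := undup_uniq _.
have w_s : w \in s by rewrite mem_undup mem_head.
have sub_f : {subset codom f <= s}.
  by move=> v f_v; rewrite mem_undup inE f_v orbT.
have sub_fw : {subset codom (extend f w) <= s}.
  move=> v; rewrite -fiber_card_gt0 fiber_card_extend addn_gt0 lt0b.
  by rewrite fiber_card_gt0 => /orP[/sub_f|/eqP->].
rewrite (fiber_shapeE t s_uniq sub_f) (fiber_shapeE t s_uniq sub_fw).
rewrite !(bigD1_seq w) //= fiber_card_extend eqxx.
under eq_bigr => v /negPf v_w do rewrite fiber_card_extend v_w addn0.
by lia.
Qed.

Lemma fiber_card_ord0 (f : 'I_0 -> T) : fiber_card f = fun=> 0.
Proof. by apply/funext => v; apply: eq_card0 => -[]. Qed.

Lemma fiber_shape_ord0 (f : 'I_0 -> T) : fiber_shape f = fun=> 0.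
Proof.
apply/funext => t; rewrite /fiber_shape fiber_card_ord0.
exact: count_pred0.
Qed.

End FibersOverOrdinals.

(** * Refining set partitions *)

Section SetPartitions.
Variable T : finType.
Implicit Types (A B D : {set T}) (P Q : {set {set T}}).

Lemma card_interpolate A D k : A \subset D -> (#|A| <= k <= #|D|)%N ->
  exists B, [/\ A \subset B, B \subset D & #|B| = k].
Proof.
move=> sAD /andP[le_Ak le_kD].
have /card_geqP[s [s_uniq size_s sub_s]] : (k - #|A| <= #|D :\: A|)%N.
  by rewrite cardsDS // leq_sub2r.
exists (A :|: [set x in s]); split; first exact: subsetUl.
  by rewrite subUset sAD; apply/subsetP => x /[!inE] /sub_s /setDP[].
rewrite cardsU (_ : _ :&: _ = set0) ?cards0 ?subn0.
  by rewrite cardsE (card_uniqP s_uniq) size_s subnKC.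
apply/setP => x; rewrite !inE; apply/negP => /andP[xA /sub_s].
by rewrite inE xA.
Qed.

Lemma card_preim_partition (rT : finType) (h : T -> rT) D :
  #|preim_partition h D| = #|h @: D|.
Proof.
pose fiber y := [set x in D | y == h x].
have -> : preim_partition h D = fiber @: (h @: D) by rewrite -imset_comp.
rewrite card_in_imset // => _ _ /imsetP[x xD ->] /imsetP[y yD ->] /setP/(_ x).
by rewrite !inE xD eqxx => /esym/eqP.
Qed.

Lemma eq_pblock_preim_partition (rT : eqType) (h : T -> rT) D :
  {in D &, forall x y,
    (pblock (preim_partition h D) x == pblock (preim_partition h D) y)
      = (h x == h y)}.
Proof.
move=> x y xD yD; have /and3P[/eqP coverD trivD _] := preim_partitionP h D.
rewrite eq_pblock ?coverD // pblock_equivalence_partition //.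
by split=> // /eqP->.
Qed.

(* The points of a set of size [k] containing a transversal of [P] represent the
   blocks of the refinement: those outside the transversal are singletons. *)
Lemma partition_refine D P k : partition P D -> (#|P| <= k <= #|D|)%N ->
  exists Q, [/\ partition Q D, #|Q| = k & {in D &, forall x y,
    pblock Q x = pblock Q y -> pblock P x = pblock P y}].
Proof.
move=> partP bounds; have trP := transversalP partP.
set X := transversal P D in trP.
have [|Y [sXY sYD cardY]] := card_interpolate (k := k) (transversal_sub trP).
  by rewrite (card_transversal trP).
pose rep x := if x \in Y then x else transversal_repr x X (pblock P x).
have blockP x : x \in D -> pblock P x \in P.
  by move=> xD; apply: pblock_mem; have /and3P[/eqP-> _ _] := partP.
have pblock_rep x : x \in D -> pblock P (rep x) = pblock P x.
  rewrite /rep => xD; case: ifP => // _.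
  by rewrite (transversal_reprK trP) ?blockP.
have rep_image : rep @: D = Y.
  apply/setP => y; apply/imsetP/idP => [[x xD ->]|yY]; last first.
    by exists y; rewrite ?(subsetP sYD) // /rep yY.
  rewrite /rep; case: ifP => // _; apply: (subsetP sXY).
  by rewrite (repr_mem_transversal trP) ?blockP.
exists (preim_partition rep D); split; first exact: preim_partitionP.
  by rewrite card_preim_partition rep_image.
move=> x y xD yD /eqP; rewrite eq_pblock_preim_partition // => /eqP eq_rep.
by rewrite -(pblock_rep x) // eq_rep pblock_rep.
Qed.

End SetPartitions.

Lemma same_blockE n (P : {set {set 'I_n}}) i j : partition P [set: 'I_n] ->
  same_block P i j = (pblock P i == pblock P j).
Proof.
move=> /and3P[/eqP coverP trivP _]; apply/exists_inP/eqP => [|eq_ij].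
  move=> [B PB /andP[Bi Bj]].
  by rewrite (def_pblock trivP PB Bi) (def_pblock trivP PB Bj).
exists (pblock P i); first by rewrite pblock_mem ?coverP ?inE.
by rewrite {2}eq_ij !mem_pblock coverP !inE.
Qed.

(** * Ideals, the last variable, and roots *)

Section IdealGenerated.
Variable A : comNzRingType.
Implicit Types (G : A -> Prop) (f g u : A).

Lemma ideal_generated0 G : ideal_generated G 0.
Proof. by exists [::]; rewrite big_nil. Qed.

Lemma ideal_generated_cons G u g f :
  G g -> ideal_generated G f -> ideal_generated G (u * g + f).
Proof.
move=> Gg [s [Gs ->]]; exists ((u, g) :: s); rewrite big_cons; split=> // ug.
by rewrite inE => /orP[/eqP->|/Gs].
Qed.

Lemma ideal_generated_ind G (P : A -> Prop) : P 0 ->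
  (forall u g f, G g -> P f -> P (u * g + f)) ->
  forall f, ideal_generated G f -> P f.
Proof.
move=> P0 Pcons _ [s [Gs ->]]; rewrite big_seq.
elim/big_rec: _ => // ug f /Gs Gug Pf; exact: Pcons.
Qed.

Lemma ideal_generatedD G f g :
  ideal_generated G f -> ideal_generated G g -> ideal_generated G (f + g).
Proof.
move=> Gf Gg; elim/ideal_generated_ind: f / Gf => [|u h f Gh Gf].
  by rewrite add0r.
by rewrite -addrA; exact: ideal_generated_cons.
Qed.

Lemma ideal_generatedMl G u f :
  ideal_generated G f -> ideal_generated G (u * f).
Proof.
elim/ideal_generated_ind: f / => [|v g f Gg Gf].
  by rewrite mulr0; exact: ideal_generated0.
by rewrite mulrDr mulrA; exact: ideal_generated_cons.
Qed.

Lemma mem_ideal_generated G g : G g -> ideal_generated G g.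
Proof.
move=> Gg; rewrite -[g]addr0 -[g in g + _]mul1r.
exact/ideal_generated_cons/ideal_generated0.
Qed.

Lemma ideal_generated_sub G G' : (forall g, G g -> ideal_generated G' g) ->
  forall f, ideal_generated G f -> ideal_generated G' f.
Proof.
move=> sGG' f; elim/ideal_generated_ind: f / => [|u g f /sGG' G'g G'f].
  exact: ideal_generated0.
exact/ideal_generatedD/G'f/ideal_generatedMl.
Qed.

End IdealGenerated.

Lemma vanishing_ideal_generated (K : comNzRingType) n
    (X : ('I_n -> K) -> Prop) (G : {mpoly K[n]} -> Prop) :
  (forall g, G g -> vanishing_ideal X g) ->
  forall f, ideal_generated G f -> vanishing_ideal X f.
Proof.
move=> Gvan f; elim/ideal_generated_ind: f / => [|u g f /Gvan Xg Xf] a Xa.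
  exact: meval0.
by rewrite mevalD mevalM Xg // Xf // mulr0 addr0.
Qed.

Lemma lead_coef_reduction (A : nzRingType) (M I : {poly A} -> Prop) :
  (forall p q, M p -> M q -> M (p - q)) ->
  I 0 -> (forall p q, I p -> I q -> I (p + q)) -> (forall p, I p -> M p) ->
  (forall q d, M q -> size q = d.+1 ->
     exists p, [/\ I p, (size p <= d.+1)%N & p`_d = q`_d]) ->
  forall q, M q -> I q.
Proof.
move=> MB I0 ID sIM lift_lead q; have [k] := ubnP (size q).
elim: k q => // k IHk q lt_qk Mq.
case size_q: (size q) => [|d].
  by move/eqP: size_q; rewrite size_poly_eq0 => /eqP->.
have [p [Ip size_p p_d]] := lift_lead _ _ Mq size_q.
rewrite -(subrK p q); apply: (ID _ _ _ Ip); apply: IHk; last exact/MB/sIM.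
have lt_dk : (d < k)%N by rewrite -size_q.
apply: leq_trans lt_dk; rewrite ltnS.
apply/leq_sizeP => j; rewrite leq_eqVlt => /orP[/eqP<-|lt_dj].
  by rewrite coefB p_d subrr.
by rewrite coefB !nth_default ?subrr ?size_q ?(leq_trans size_p).
Qed.

Section LastVariable.
Variables (K : comNzRingType) (n : nat).
Implicit Types (q : {poly {mpoly K[n]}}) (f : {mpoly K[n]}) (a : 'I_n -> K).

Lemma mmultiE q : mmulti q = (mpwiden q).['X_ord_max].
Proof.
rewrite (horner_coef_wide _ (size_poly _ _)).
by apply: eq_bigr => i _; rewrite coef_map.
Qed.

Lemma mmulti_is_zmod_morphism : zmod_morphism (@mmulti n K).
Proof. by move=> p q; rewrite !mmultiE rmorphB hornerD hornerN. Qed.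

Lemma mmulti_is_monoid_morphism : monoid_morphism (@mmulti n K).
Proof.
by split=> [|p q]; rewrite !mmultiE ?rmorph1 ?hornerC // rmorphM hornerM.
Qed.

HB.instance Definition _ :=
  GRing.isZmodMorphism.Build _ _ (@mmulti n K) mmulti_is_zmod_morphism.
HB.instance Definition _ :=
  GRing.isMonoidMorphism.Build _ _ (@mmulti n K) mmulti_is_monoid_morphism.

Lemma mmultiC f : mmulti f%:P = mwiden f.
Proof. by rewrite mmultiE mpwidenC hornerC. Qed.

Lemma mmultiX : mmulti 'X = 'X_ord_max :> {mpoly K[n.+1]}.
Proof. by rewrite mmultiE mpwidenX hornerX. Qed.

Lemma mwidenXU i :
  mwiden 'X_i = 'X_(widen_ord (leqnSn n) i) :> {mpoly K[n.+1]}.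
Proof. by rewrite mwidenX mnmwiden1. Qed.

Lemma muniK : cancel (@muni n K) (@mmulti n K).
Proof.
move=> f; rewrite muniE rmorph_sum [RHS]mpolyE; apply: eq_bigr => k _ /=.
rewrite -mul_polyC rmorphM rmorphXn /= mmultiC mmultiX mwidenZ -scalerAl.
rewrite mpolyXE_id [in RHS]mpolyXE_id rmorph_prod big_ord_recr /=.
congr (_ *: (_ * _)).
by apply: eq_bigr => i _; rewrite rmorphXn /= mwidenXU mnmE.
Qed.

Lemma meval_mwiden_extend a v f : (mwiden f).@[extend a v] = f.@[a].
Proof.
rewrite (mpolyE f) [mwiden _]raddf_sum !raddf_sum; apply: eq_bigr => k _ /=.
rewrite mwidenZ !mevalZ mpolyXE_id !rmorph_prod; congr (_ * _).
by apply: eq_bigr => i _; rewrite !rmorphXn /= mwidenXU !mevalXU extend_widen.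
Qed.

Lemma meval_mmulti_extend a v q :
  (mmulti q).@[extend a v] = (map_poly (meval a) q).[v].
Proof.
rewrite mmultiE -horner_map /= mevalXU extend_max -map_poly_comp.
by congr _.[v]; apply: eq_map_poly => f /=; exact: meval_mwiden_extend.
Qed.

End LastVariable.

Lemma separable_XnsubC (F : fieldType) m (w : F) :
  m%:R != 0 :> F -> w != 0 -> separable_poly ('X^m - w%:P).
Proof.
case: m => [/eqP//|m m_neq0 w_neq0]; rewrite unlock linearB /= derivC subr0.
rewrite derivXn -scaler_nat coprimepZr //= exprS coprimep_sym.
rewrite coprimep_addl_mul -alg_polyC -scaleNr.
by rewrite coprimepZr ?oppr_eq0 ?coprimep1.
Qed.

Section ClosedField.
Variable F : closedFieldType.
Implicit Types (w : F) (p : {poly F}).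

Definition nth_roots m w : seq F :=
  sval (closed_field_poly_normal ('X^m - w%:P)).

Lemma prod_nth_roots m w : (0 < m)%N ->
  \prod_(z <- nth_roots m w) ('X - z%:P) = 'X^m - w%:P.
Proof.
move=> m_gt0; rewrite /nth_roots; case: closed_field_poly_normal => rs /=.
by rewrite (monicP (monicXnsubC w m_gt0)) scale1r => <-.
Qed.

Lemma size_nth_roots m w : (0 < m)%N -> size (nth_roots m w) = m.
Proof.
move=> m_gt0; apply: succn_inj; rewrite -(size_prod_XsubC _ id).
by rewrite prod_nth_roots ?size_XnsubC.
Qed.

Lemma mem_nth_roots m w z : (0 < m)%N -> (z \in nth_roots m w) = (z ^+ m == w).
Proof.
move=> m_gt0; rewrite -root_prod_XsubC prod_nth_roots // rootE !hornerE.
exact: subr_eq0.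
Qed.

Lemma uniq_nth_roots m w : m%:R != 0 :> F -> w != 0 -> uniq (nth_roots m w).
Proof.
move=> m_neq0 w_neq0; rewrite -separable_prod_XsubC prod_nth_roots.
  exact: separable_XnsubC.
by rewrite lt0n; apply: contra_neq m_neq0 => ->.
Qed.

Lemma poly_eq0_nonzero_roots p : (forall v, v != 0 -> root p v) -> p = 0.
Proof.
move=> roots_p; apply/eqP/negPn/negP => p_neq0.
have /closed_nonrootP[v] : p * 'X != 0 by rewrite mulf_neq0 ?polyX_eq0.
rewrite rootM negb_or rootX => /andP[/negP p_v v_neq0].
exact/p_v/roots_p.
Qed.

Lemma poly_eq0_fiber_powers (I : finType) (b : I -> F) m x p :
  m%:R != 0 :> F -> (forall i, b i != 0) ->
  (forall v, v != 0 -> (x <= fiber_card b (v ^+ m))%N -> root p v) ->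
  (forall y, (y < x)%N -> (size p <= m * fiber_shape b y)%N) -> p = 0.
Proof.
move=> m_neq0 b_neq0; case: x => [|y] roots_p size_p.
  by apply: poly_eq0_nonzero_roots => v v_neq0; apply: roots_p.
have m_gt0 : (0 < m)%N by rewrite lt0n; apply: contra_neq m_neq0 => ->.
pose ws := [seq w <- undup (codom b) | (y < fiber_card b w)%N].
have ws_neq0 w : w \in ws -> w != 0.
  by rewrite mem_filter mem_undup => /andP[_ /codomP[i ->]].
apply: (@roots_geq_poly_eq0 _ p [seq z | w <- ws, z <- nth_roots m w]).
- apply/allP => _ /allpairsPdep[w [z [+ + ->]]].
  rewrite mem_nth_roots // => /[swap] /eqP<- zm_ws.
  apply: roots_p; last by move: zm_ws; rewrite mem_filter => /andP[].
  by have := ws_neq0 _ zm_ws; rewrite expf_eq0 m_gt0.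
- apply: allpairs_uniq_dep => [|w w_ws|].
  + exact/filter_uniq/undup_uniq.
  + exact/uniq_nth_roots/ws_neq0.
  move=> _ _ /allpairsPdep[w [z [_ + ->]]] /allpairsPdep[w' [z' [_ + ->]]] /=.
  by rewrite !mem_nth_roots // => /eqP<- /eqP<- ->.
rewrite size_allpairs_dep sumnE big_map.
under eq_bigr do rewrite size_nth_roots //.
by rewrite big_const_seq count_predT iter_addn_0 size_filter size_p.
Qed.

End ClosedField.

(** * Difference products *)

Section DifferenceProducts.
Variables (K : comNzRingType) (m : nat).

Definition difference_product n (e : rel 'I_n) : {mpoly K[n]} :=
  \prod_(i < n) \prod_(j < n | (i < j)%N && e i j) ('X_i ^+ m - 'X_j ^+ m).

Definition color_product n (c : 'I_n -> nat) : {mpoly K[n]} :=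
  difference_product (fun i j => c i == c j).

Definition color_generator n (D : (nat -> nat) -> Prop) (g : {mpoly K[n]}) :=
  exists c : 'I_n -> nat,
    [/\ is_shape (fiber_card c), D (fiber_card c) & g = color_product c].

Definition powers n (a : 'I_n -> K) i := a i ^+ m.

Definition shape_locus n (D : (nat -> nat) -> Prop) (a : 'I_n -> K) :=
  (forall i, a i != 0) /\ ~ D (fiber_shape (powers a)).

Lemma difference_product_subrel n (e e' : rel 'I_n) : subrel e' e ->
  exists w, difference_product e = w * difference_product e'.
Proof.
move=> sub_e; exists (difference_product (fun i j => e i j && ~~ e' i j)).
rewrite mulrC -big_split; apply: eq_bigr => i _ /=.
rewrite (bigID (e' i)) /=; congr (_ * _); apply: eq_bigl => j.
  by case: (boolP (e' i j)) => [/sub_e->|_]; rewrite ?andbT ?andbF.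
by rewrite andbA.
Qed.

Lemma color_product_extend n (c : 'I_n -> nat) x :
  color_product (extend c x) = mwiden (color_product c) *
    \prod_(i < n | c i == x)
      ('X_(widen_ord (leqnSn n) i) ^+ m - 'X_ord_max ^+ m).
Proof.
rewrite /color_product /difference_product big_ord_recr /=.
rewrite [X in _ * X]big_pred0 => [|j]; last by rewrite ltnNge -ltnS ltn_ord.
rewrite mulr1 rmorph_prod [X in _ * X]big_mkcond -big_split.
apply: eq_bigr => i _ /=; rewrite big_mkcond big_ord_recr /= ltn_ord.
rewrite extend_widen extend_max rmorph_prod; congr (_ * _).
rewrite [RHS]big_mkcond; apply: eq_bigr => j _ /=.
by rewrite extend_widen rmorphB !rmorphXn /= !mwidenXU.
Qed.

Lemma powers_extend n (a : 'I_n -> K) v :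
  powers (extend a v) = extend (powers a) (v ^+ m).
Proof. by apply/funext => i; rewrite /powers /extend; case: unlift. Qed.

Lemma vanishing_shape_locus_ord0 D (f : {mpoly K[0]}) :
  vanishing_ideal (shape_locus D) f -> ideal_generated (color_generator D) f.
Proof.
rewrite [f]nvar0_mpolyC => van; have [D0|notD0] := EM (D (fun=> 0%N)).
  rewrite -[_%:MP]mulr1; apply/ideal_generatedMl/mem_ideal_generated.
  exists (fun=> 0%N); rewrite fiber_card_ord0; split=> //.
  by rewrite /color_product /difference_product big_ord0.
have /van : shape_locus D (fun _ : 'I_0 => 0 : K).
  by split=> [[]|] //; rewrite fiber_shape_ord0.
by rewrite mevalC => ->; rewrite mpolyC0; exact: ideal_generated0.
Qed.

End DifferenceProducts.

Section IntegralDomain.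
Variables (K : idomainType) (m : nat).

Lemma meval_difference_product_neq0P n (e : rel 'I_n) (a : 'I_n -> K) :
  ssrbool.symmetric e ->
  reflect (forall i j, e i j -> powers m a i = powers m a j -> i = j)
    ((difference_product K m e).@[a] != 0).
Proof.
move=> e_sym; rewrite rmorph_prod /=.
have factorE i j : ('X_i ^+ m - 'X_j ^+ m).@[a] = powers m a i - powers m a j.
  by rewrite mevalB !rmorphXn /= !mevalXU.
apply: (iffP (prodf_neq0 _ _)) => [nz i j eij eq_ij|inj i _].
  wlog lt_ij : i j eij eq_ij / (i < j)%N.
    move=> wlog_lt; case: (ltngtP i j) => [||/val_inj//]; first exact: wlog_lt.
    by move=> lt_ji; apply/esym/wlog_lt; rewrite // e_sym.
  move: (nz i isT); rewrite rmorph_prod => /prodf_neq0/(_ j) /=.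
  by rewrite lt_ij eij factorE eq_ij subrr eqxx => /(_ isT).
rewrite rmorph_prod; apply/prodf_neq0 => j /= /andP[lt_ij eij].
rewrite factorE subr_eq0; apply/eqP => /(inj _ _ eij) eq_ij.
by rewrite eq_ij ltnn in lt_ij.
Qed.

Lemma color_generator_vanishing n D (g : {mpoly K[n]}) : dominance_closed D ->
  color_generator m D g -> vanishing_ideal (shape_locus m D) g.
Proof.
move=> closedD [c [shape_c Dc ->]] a [_ notD].
apply/eqP/negPn/negP => /meval_difference_product_neq0P inj; apply: notD.
apply: closedD (is_shape_fiber_shape _) _ Dc => //.
apply: fiber_card_dominated => i j /eqP eq_c.
by apply: inj => // k l; rewrite eq_sym.
Qed.

Lemma partition_product_vanishing n p (P : {set {set 'I_n}}) :
  partition P [set: 'I_n] -> (#|P| < p)%N ->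
  vanishing_ideal (equal_powers_locus m p) (partition_product K m P).
Proof.
move=> partP lt_Pp a [I [cardI eqI]]; have /and3P[/eqP coverP _ _] := partP.
apply/eqP; apply: contraTT lt_Pp => /meval_difference_product_neq0P inj.
rewrite -leqNgt -cardI -(@card_in_imset _ _ (pblock P)) => [|i j iI jI eq_ij].
  apply/subset_leq_card/subsetP => _ /imsetP[i _ ->].
  by rewrite pblock_mem ?coverP ?inE.
apply: inj; [|by rewrite same_blockE // eq_ij|exact: eqI].
by move=> k l; rewrite !same_blockE // eq_sym.
Qed.

Hypothesis m_gt0 : (0 < m)%N.

Definition join_poly n (c : 'I_n -> nat) x : {poly {mpoly K[n]}} :=
  \prod_(i < n | c i == x) ('X^m - ('X_i ^+ m)%:P).

Lemma join_poly_monic n (c : 'I_n -> nat) x : join_poly c x \is monic.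
Proof. by apply: monic_prod => i _; exact: monicXnsubC. Qed.

Lemma size_join_poly n (c : 'I_n -> nat) x :
  size (join_poly c x) = (m * fiber_card c x).+1.
Proof.
rewrite size_prod => [|i _]; last by rewrite monic_neq0 ?monicXnsubC.
under eq_bigr do rewrite size_XnsubC //.
by rewrite sum_nat_const /fiber_card cardsE mulnS -addnS addKn mulnC.
Qed.

Lemma mmulti_join_poly n (c : 'I_n -> nat) x :
  mwiden (color_product K m c) * mmulti (join_poly c x)
    = (-1) ^+ fiber_card c x * color_product K m (extend c x).
Proof.
rewrite color_product_extend mulrCA; congr (_ * _).
rewrite /fiber_card cardsE -prodrN rmorph_prod; apply: eq_bigr => i _ /=.
by rewrite opprB rmorphB /= rmorphXn /= mmultiX mmultiC rmorphXn /= mwidenXU.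
Qed.

(* The last index joins a class of size at most [d %/ m]; powers of the last
   variable then raise the degree to [d]. *)
Lemma color_generator_lift n D d (g : {mpoly K[n]}) :
  color_generator m (add_box_preimage (d %/ m) D) g ->
  exists q : {poly {mpoly K[n]}}, [/\ (size q <= d.+1)%N, q`_d = g
    & ideal_generated (color_generator m D) (mmulti q)].
Proof.
move=> [c [shape_c [x first_x Dx] ->]].
pose k := (d - m * fiber_card c x)%N.
have dE : (k + m * fiber_card c x = d)%N.
  by rewrite subnK // mulnC -leq_divRL //; case: first_x.
pose h := 'X^k * join_poly c x.
have h_monic : h \is monic by rewrite monicMl ?monicXn ?join_poly_monic.
have size_h : size h = d.+1.
  rewrite size_monicM ?monicXn ?monic_neq0 ?join_poly_monic //.
  by rewrite size_polyXn size_join_poly // addnS addSn dE.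
exists ((color_product K m c)%:P * h); split.
- by rewrite mul_polyC -size_h size_scale_leq.
- rewrite coefCM; have := monicP h_monic.
  by rewrite lead_coefE size_h => ->; rewrite mulr1.
rewrite !rmorphM /= mulrCA mmultiC mmulti_join_poly mulrA.
apply/ideal_generatedMl/mem_ideal_generated; exists (extend c x).
have -> : fiber_card (extend c x) = add_box (fiber_card c) x.
  exact/funext/fiber_card_extend.
by split=> //; exact: is_shape_add_box first_x.
Qed.

Lemma color_ideal_lift n D d (f : {mpoly K[n]}) :
  ideal_generated (color_generator m (add_box_preimage (d %/ m) D)) f ->
  exists q : {poly {mpoly K[n]}}, [/\ (size q <= d.+1)%N, q`_d = f
    & ideal_generated (color_generator m D) (mmulti q)].
Proof.
elim/ideal_generated_ind: f / => [|u g f /color_generator_lift[q]].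
  exists 0; rewrite size_poly0 coef0 rmorph0; split=> //.
  exact: ideal_generated0.
move=> [size_q q_d Iq] [p [size_p p_d Ip]]; exists (u%:P * q + p); split.
- rewrite (leq_trans (size_polyD _ _)) // geq_max size_p andbT mul_polyC.
  exact: leq_trans (size_scale_leq _ _) size_q.
- by rewrite coefD coefCM q_d p_d.
by rewrite rmorphD rmorphM; apply/ideal_generatedD/Ip/ideal_generatedMl.
Qed.

End IntegralDomain.

(** * Vanishing ideals *)

Section VanishingIdeal.
Variables (F : closedFieldType) (m : nat).
Hypothesis m_neq0 : m%:R != 0 :> F.

Let m_gt0 : (0 < m)%N.
Proof. by rewrite lt0n; apply: contra_neq m_neq0 => ->. Qed.

(* Every nonzero [v] whose [m]-th power is already taken [x] times extends [a]
   to a point of the locus, and there are more than [d] of them. *)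
Lemma coef_vanishing n D d (q : {poly {mpoly F[n]}}) : dominance_closed D ->
  vanishing_ideal (shape_locus m D) (mmulti q) -> (size q <= d.+1)%N ->
  vanishing_ideal (shape_locus m (add_box_preimage (d %/ m) D)) q`_d.
Proof.
move=> closedD van size_q a [a_neq0 notD].
have shape_a := is_shape_fiber_shape (powers m a).
have [x first_x] := first_le_exists (d %/ m) shape_a.
rewrite -coef_map /= (_ : map_poly _ _ = 0) ?coef0 //.
apply: (@poly_eq0_fiber_powers _ _ (powers m a) m x) => // [i|v v_neq0 le_xv|].
- by rewrite expf_eq0 m_gt0 a_neq0.
- rewrite rootE -meval_mmulti_extend; apply/eqP/van; split.
    by move=> i; rewrite /extend; case: unlift.
  rewrite powers_extend fiber_shape_extend => Dv; apply: notD; exists x => //.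
  apply: closedD Dv; last exact: dominated_add_box.
    by rewrite -fiber_shape_extend; exact: is_shape_fiber_shape.
  exact: is_shape_add_box first_x.
move=> y lt_yx; apply: leq_trans (size_poly _ _) (leq_trans size_q _).
by rewrite mulnC -ltn_divLR //; case: first_x => _; apply.
Qed.

Theorem vanishing_ideal_shape_locus n D (f : {mpoly F[n]}) :
  dominance_closed D ->
  vanishing_ideal (shape_locus m D) f <->
  ideal_generated (color_generator m D) f.
Proof.
move=> closedD; split; last first.
  by apply: vanishing_ideal_generated => g; exact: color_generator_vanishing.
elim: n => [|n IHn] in D closedD f *; first exact: vanishing_shape_locus_ord0.
rewrite -[f]muniK; move: (muni f).
apply: (@lead_coef_reduction _ (fun q => vanishing_ideal _ (mmulti q))).
- move=> p q van_p van_q a locus_a.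
  by rewrite rmorphB mevalB van_p // van_q // subrr.
- by rewrite rmorph0; exact: ideal_generated0.
- by move=> p q Ip Iq; rewrite rmorphD; exact: ideal_generatedD.
- move=> p; apply: vanishing_ideal_generated => g.
  exact: color_generator_vanishing.
move=> q d van_q size_q.
have /IHn := coef_vanishing closedD van_q (eq_leq size_q).
case/(_ (dominance_closed_add_box_preimage closedD))/color_ideal_lift => // p.
by move=> [size_p p_d Ip]; exists p.
Qed.

Lemma shape_locus_equal_powers n r (a : 'I_n -> F) :
  shape_locus m (fun lam => (n <= prefix_sum lam r)%N) a ->
  equal_powers_locus m r.+1 a.
Proof.
move=> [_ /negP]; rewrite -ltnNge -[X in (_ < X)%N]card_ord.
move=> /prefix_sum_fiber_shape_lt[v lt_rv].
have [|I [_ /subsetP sI cardI]] := card_interpolate (k := r.+1)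
  (sub0set [set i | powers m a i == v]); first by rewrite cards0.
exists I; split=> // i j /sI /[!inE] /eqP a_i /sI /[!inE] /eqP a_j.
exact: etrans a_i (esym a_j).
Qed.

Lemma color_generator_partition_ideal n r (g : {mpoly F[n]}) : (r <= n)%N ->
  color_generator m (fun lam => (n <= prefix_sum lam r)%N) g ->
  ideal_generated (@partition_generator F n m r) g.
Proof.
move=> le_rn [c [_ + ->]]; rewrite prefix_sum_fiber_card => full.
have c_lt i : (c i < r)%N.
  suff /setP/(_ i) : [set j | (c j < r)%N] = [set: 'I_n] by rewrite !inE.
  by apply/eqP; rewrite eqEcard subsetT cardsT card_ord.
pose c_r i := Ordinal (c_lt i).
have [|Q [partQ cardQ refQ]] :=
    partition_refine (k := r) (preim_partitionP c_r [set: 'I_n]).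
  rewrite card_preim_partition cardsT card_ord le_rn andbT.
  by apply: leq_trans (max_card _) _; rewrite card_ord.
have [|w] := @difference_product_subrel F m n
    (fun i j => c i == c j) (same_block Q).
  move=> i j; rewrite same_blockE // => /eqP/(refQ _ _ (in_setT _) (in_setT _)).
  by move/eqP; rewrite eq_pblock_preim_partition ?inE.
rewrite /color_product => ->; apply/ideal_generatedMl/mem_ideal_generated.
by exists Q.
Qed.

Theorem vanishing_ideal_equal_powers_locus n r (f : {mpoly F[n]}) :
  (r <= n)%N ->
  vanishing_ideal (@equal_powers_locus F n m r.+1) f <->
  ideal_generated (@partition_generator F n m r) f.
Proof.
move=> le_rn; split=> [van|]; last first.
  apply: vanishing_ideal_generated => _ [P [partP cardP ->]].
  by apply: partition_product_vanishing; rewrite ?cardP.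
apply: (ideal_generated_sub (G := color_generator m _)) => [g|].
  exact: color_generator_partition_ideal.
apply/vanishing_ideal_shape_locus; first exact: dominance_closed_prefix_sum.
by move=> a /shape_locus_equal_powers; exact: van.
Qed.

End VanishingIdeal.

Theorem theorem1p3 (R : realType) (n m p : nat)
    (hm : (2 <= m)%N) (hp : (2 <= p)%N) (hpn : (p <= n)%N)
    (f : {mpoly R[i][n]}) :
  vanishing_ideal (@equal_powers_locus R[i] n m p) f <->
  ideal_generated (@partition_generator R[i] n m (p - 1)) f.
Proof.
case: p hp hpn => // r _ lt_rn; rewrite subn1.
apply: vanishing_ideal_equal_powers_locus; last exact: ltnW.
by rewrite pnatr_eq0 -lt0n ltnW.
Qed.
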